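(* Let $m\ge 4$ and $h\ge 0$, and let $(G,D)$ be a finite $3$-transposition group of type $2^{\bullet h}{:}\operatorname{Sym}(m)$. Then the diagram of $(G,D)$ has size $n=2^{h-1}m(m-1)$ and spectrum $$((\,2^{h+1}(m-2);\ [2^h(m-4)]^{m-1},\ [-2^{h+1}]^{m(m-3)/2},\ [0]^{\star}\,)).$$
   Context: A $3$-transposition group $(G,D)$ is a group $G$ generated by a conjugacy class $D$ of elements of order $2$ such that $|de|\in\{1,2,3\}$ for all $d,e\in D$. Its diagram is the graph with vertex set $D$ in which $d$ and $e$ are adjacent iff $|de|=3$; its size is $n=|D|$. The spectrum is that of the $(0,1)$-adjacency matrix, written $((k;\dots,[r]^c,\dots))$: first the degree $k$ of the (regular) diagram, counted once, then the remaining eigenvalues, $[r]^c$ meaning $r$ with multiplicity $c$; if listed values coincide, their multiplicities are added, and $[r]^\star$ means that $r$ has whatever further multiplicity (possibly zero) is required for the total multiplicity to be $n$. $(G,D)$ has type $2^{\bullet h}{:}\operatorname{Sym}(m)$ if $G$ has a normal $2$-subgroup $N$ with $|D\cap dN|=2^h$ for all $d\in D$ and $(G/N,DN/N)$ is isomorphic to $\operatorname{Sym}(m)$ with its class of transpositions. (The diagram depends only on $2^h$ and the quotient; whether the extension splits plays no role.) *)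

(* Defs.v *)
From mathcomp Require Import all_boot all_order all_algebra all_fingroup.
From mathcomp Require Import all_solvable.

Set Implicit Arguments.
Unset Strict Implicit.
Unset Printing Implicit Defensive.

Import GRing.Theory.

Section ThreeTranspositions.

Local Open Scope group_scope.

Variables (gT : finGroupType) (G : {group gT}) (D : {set gT}).

Definition three_transposition_group : Prop :=
  [/\ D \in classes G,
      <<D>> = G,
      {in D, forall d, #[d] = 2}
    & {in D &, forall d e, #[d * e] \in [:: 1; 2; 3]%N}].

Definition transpositions (m : nat) : {set 'S_m} :=
  [set tperm p.1 p.2 | p : 'I_m * 'I_m & p.1 != p.2].

Definition has_type_2h_Sym (h m : nat) : Prop :=
  exists N : {group gT},
    [/\ N <| G, 2.-group N,
        {in D, forall d, #|D :&: d *: N| = (2 ^ h)%N}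
      & exists2 f : {morphism G / N >-> 'S_m},
          isom (G / N) [set: 'S_m] f & f @* (D / N) = transpositions m].

Definition diagram : rel gT := fun d e => #[d * e] == 3.

End ThreeTranspositions.

Local Open Scope ring_scope.

Section Spectrum.

Variable C : numClosedFieldType.

Definition adjacency (T : finType) (V : {set T}) (e : rel T) : 'M[C]_#|V| :=
  \matrix_(i, j) (e (enum_val i) (enum_val j))%:R.

(* The roots of the characteristic polynomial, with multiplicity; only
   meaningful up to permutation. *)
Definition spectrum (n : nat) (A : 'M[C]_n) : seq C :=
  sval (closed_field_poly_normal (char_poly A)).

Definition regular_graph (T : finType) (V : {set T}) (e : rel T) (k : nat) :
    Prop :=
  {in V, forall x, #|[set y in V | e x y]| = k}.

(* ((k; [r_1]^c_1, ..., [r_t]^c_t, [s]^star )) with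
   l = [:: (r_1, c_1); ...; (r_t, c_t)].  The exponent c of s is determined by
   the sizes of the two sequences. *)
Definition graph_spectrum_star (T : finType) (V : {set T}) (e : rel T)
    (k : nat) (l : seq (C * nat)) (s : C) : Prop :=
  regular_graph V e k /\
  exists c : nat,
    perm_eq (spectrum (adjacency V e))
      (k%:R :: flatten [seq nseq p.2 p.1 | p <- l] ++ nseq c s).

End Spectrum.

(* Main.v *)
(** Modulo [N], every [d] in [D] becomes a transposition, whose support is a
    2-subset of ['I_m]; [d] and [e] are adjacent iff these supports meet in
    exactly one point, and every 2-subset arises from [q = 2 ^ h] elements.  So
    the adjacency matrix is [F S F^T] with [F^T F = q I], where [S] is the
    adjacency matrix of the triangular graph on the 2-subsets, and up to powers
    of ['X] its characteristic polynomial is that of [q S].  With [R] the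
    incidence matrix of 2-subsets and points, [R R^T = 2 I + S] while
    [R^T R = (m - 2) I + J], so comparing [det (a - A B)] with [det (a - B A)]
    twice more reduces everything to a 1 x 1 determinant. *)

Require Import Defs.
From mathcomp Require Import all_boot all_order all_algebra all_fingroup.
From mathcomp Require Import all_solvable.
From mathcomp Require Import zify ring.

Set Implicit Arguments.
Unset Strict Implicit.
Unset Printing Implicit Defensive.

Import GRing.Theory Num.Theory.

Local Open Scope ring_scope.

(** * Exchanging the factors of a matrix product inside a determinant *)

(** The block [B] of [L] is eliminated twice: a column operation shows
    [\det L = \det (a%:M - A *m B)], and a row operation that scales the lower rows by [a] gives [a
    ^+ p * \det L = a ^+ n * \det (a%:M - B *m A)]. No division by [a] occurs, so [a] may be a
    polynomial. *)
Lemma det_scalar_sub_mulmxC (R : comNzRingType) (n p : nat) (a : R)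
    (A : 'M[R]_(n, p)) (B : 'M[R]_(p, n)) :
  a ^+ p * \det (a%:M - A *m B) = a ^+ n * \det (a%:M - B *m A).
Proof.
pose L := block_mx a%:M A B 1%:M.
have LAB : \det L = \det (a%:M - A *m B).
  have := det_mulmx L (block_mx 1%:M 0 (- B) 1%:M).
  rewrite mulmx_block !mulmx1 !mulmx0 mul1mx subrr !add0r mulmxN.
  by rewrite det_ublock det_lblock !det1 !mulr1.
have := det_mulmx (block_mx 1%:M 0 (- B) a%:M) L.
rewrite mulmx_block !mul1mx !mul0mx !addr0 mulmx1 mulNmx mul_mx_scalar.
rewrite mul_scalar_mx addNr det_ublock det_lblock !det_scalar expr1n mul1r.
by rewrite LAB mulNmx addrC => <-.
Qed.

Lemma char_poly_mulmxC (R : comNzRingType) (n p : nat)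
    (A : 'M[R]_(n, p)) (B : 'M[R]_(p, n)) :
  'X^p * char_poly (A *m B) = 'X^n * char_poly (B *m A).
Proof.
by rewrite /char_poly /char_poly_mx !map_mxM /= det_scalar_sub_mulmxC.
Qed.

(** * Counting 2-subsets *)

Lemma card_pairs_containing (T : finType) (x : T) :
  #|[set A : {set T} | (#|A| == 2)%N & x \in A]| = #|T|.-1.
Proof.
have -> : [set A : {set T} | (#|A| == 2)%N & x \in A]
    = [set [set x; y] | y in [set~ x]].
  apply/setP => A; rewrite inE;
    apply/andP/imsetP => [[/cards2P[y [z [yz ->]]]]|].
    rewrite !inE => /orP[]/eqP ->; first by exists z; rewrite // !inE eq_sym.
    by exists y; rewrite ?inE // setUC.
  by move=> [y]; rewrite !inE eq_sym => xy ->; rewrite cards2 xy !inE eqxx.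
rewrite card_in_imset ?cardsC1 // => y z; rewrite !inE => yx _ /setP/(_ y).
by rewrite !inE eqxx orbT (negbTE yx) => /esym/eqP.
Qed.

Lemma card_pairs_containing2 (T : finType) (x y : T) : x != y ->
  #|[set A : {set T} | [&& #|A| == 2, x \in A & y \in A]%N]| = 1%N.
Proof.
move=> xy; apply/eqP/cards1P; exists [set x; y]; apply/setP => A; rewrite !inE.
apply/and3P/eqP => [[/eqP A2 xA yA]|->]; last first.
  by rewrite cards2 xy !inE !eqxx orbT.
by apply/esym/eqP; rewrite eqEcard A2 cards2 xy subUset !sub1set xA yA.
Qed.

(** Two 2-subsets meet in two points only if they are equal. The additive form serves both the
    double count of neighbours and the entries of [incidence] times its transpose. *)
Lemma cardsI_pairs (T : finType) (A B : {set T}) : #|A| = 2%N -> #|B| = 2%N ->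
  #|A :&: B| = ((#|A :&: B| == 1) + (A == B).*2)%N.
Proof.
move=> A2 B2; case: (eqVneq A B) => [->|AB]; first by rewrite setIid B2.
have : (#|A :&: B| < 2)%N.
  rewrite ltnNge; apply: contra AB => AB2.
  have IA : A :&: B = A by apply/eqP; rewrite eqEcard subsetIl A2.
  by rewrite eqEcard A2 B2 leqnn andbT; apply/setIidPl.
by case: (#|_|) => [|[|]].
Qed.

(** Double counting: each of the two points of [B] lies in [#|T|.-1] 2-subsets, and [A = B] alone
    contributes 2 to the sum of all [#|B :&: A|]. *)
Lemma card_pairs_meeting (T : finType) (B : {set T}) : #|B| = 2%N ->
  #|[set A : {set T} | (#|A| == 2)%N & #|B :&: A| == 1%N]| = (2 * (#|T| - 2))%N.
Proof.
move=> B2.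
have T2 : (2 <= #|T|)%N by rewrite -B2 max_card.
have : (\sum_(A : {set T} | #|A| == 2) #|B :&: A| = 2 * #|T|.-1)%N.
  have cardI A : #|B :&: A| = (\sum_(x in B) (x \in A))%N.
    rewrite -sum1_card [LHS](eq_bigl (fun x => (x \in B) && (x \in A))).
      by rewrite big_mkcondr; apply: eq_bigr => x _; case: ifP.
    by move=> x; rewrite inE.
  under eq_bigr => A _ do rewrite cardI.
  rewrite exchange_big /= -[X in (X * _)%N]B2 -sum_nat_const.
  apply: eq_bigr => x _.
  rewrite -(card_pairs_containing x) -[RHS]sum1_card.
  rewrite [RHS](eq_bigl (fun A : {set T} => (#|A| == 2)%N && (x \in A))).
    by rewrite big_mkcondr; apply: eq_bigr => A _; case: ifP.
  by move=> A; rewrite inE.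
under eq_bigr => A /eqP A2 do rewrite cardsI_pairs //.
rewrite big_split /= -big_mkcondr sum1_card.
rewrite (bigD1 B) /= ?B2 // eqxx big1 ?addn0; last first.
  move=> A /andP[_ /negbTE].
  by rewrite eq_sym => ->.
rewrite [X in (X + _)%N]
  (_ : _ = #|[set A : {set T} | (#|A| == 2)%N & #|B :&: A| == 1%N]|).
  by move: T2; set c := #|_|; set d := #|_|; lia.
by apply: eq_card => A; rewrite inE.
Qed.

(** * The triangular graph and its characteristic polynomial *)

Definition pairs (m : nat) : {set {set 'I_m}} :=
  [set A : {set 'I_m} | #|A| == 2%N].

(** On [pairs m] this is adjacency in the triangular graph, irreflexive there because a 2-subset
    meets itself in two points. *)
Definition meet1 (m : nat) : rel {set 'I_m} :=
  fun A B : {set 'I_m} => #|A :&: B| == 1%N.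

Lemma card_pair m (k : 'I_#|pairs m|) :
  #|(enum_val k : {set 'I_m})| = 2%N.
Proof.
by have : enum_val k \in pairs m := enum_valP k; rewrite inE => /eqP.
Qed.

Lemma card_pairs m : #|pairs m| = 'C(m, 2).
Proof. by rewrite card_draws card_ord. Qed.

Definition incidence (R : pzRingType) (m : nat) : 'M[R]_(#|pairs m|, m) :=
  \matrix_(k < #|pairs m|, j < m) (j \in (enum_val k : {set 'I_m}))%:R.

Lemma incidence_mul_tr (C : numClosedFieldType) m :
  incidence C m *m (incidence C m)^T = 2%:M + adjacency C (pairs m) (@meet1 m).
Proof.
apply/matrixP => k l; rewrite !mxE.
transitivity (#|(enum_val k : {set 'I_m}) :&: enum_val l|%:R : C).
  rewrite -[in RHS]sum1_card natr_sum [RHS]big_mkcond; apply: eq_bigr => j _.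
  by rewrite !mxE inE -natrM mulnb; case: ifP.
rewrite cardsI_pairs ?card_pair // (inj_eq enum_val_inj) /meet1 natrD addrC.
congr (_ + _).
by case: eqP.
Qed.

(** The entry at [(i, j)] counts the 2-subsets through both points: [m.+1] if [i = j], and one
    otherwise. *)
Lemma tr_incidence_mul (R : pzRingType) m :
  (incidence R m.+2)^T *m incidence R m.+2 = m%:R%:M + const_mx 1.
Proof.
apply/matrixP => i j; rewrite !mxE.
transitivity (#|[set A in pairs m.+2 | (i \in A) && (j \in A)]|%:R : R).
  rewrite -[in RHS]sum1_card natr_sum [RHS]big_mkcond.
  rewrite [RHS](bigID (mem (pairs m.+2))) /=.
  rewrite [X in _ = _ + X]big1 ?addr0 => [|A /negbTE nA]; last first.
    by rewrite inE nA.
  rewrite [RHS]big_enum_val; apply: eq_bigr => k _.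
  by rewrite !mxE !inE -natrM mulnb; rewrite card_pair /=; case: ifP.
case: eqVneq => [<-|ij].
  rewrite mulr1n natr1; congr _%:R.
  transitivity #|'I_m.+2|.-1; last by rewrite card_ord.
  rewrite -(card_pairs_containing i).
  by apply: eq_card => A; rewrite !inE andbb.
rewrite mulr0n add0r -[RHS]/(1%:R) -(card_pairs_containing2 ij); congr _%:R.
by apply: eq_card => A; rewrite !inE.
Qed.

(** The all-ones matrix is a column times a row, so exchanging the factors leaves a 1 x 1
    determinant; the extra factor [a] cancels. *)
Lemma det_scalar_sub_scale_allones (R : idomainType) n (a b : R) : a != 0 ->
  \det (a%:M - b *: const_mx 1 : 'M_n.+1) = a ^+ n * (a - n.+1%:R * b).
Proof.
move=> a0; apply: (mulfI a0).
have -> : b *: const_mx 1 = (const_mx b : 'cV_n.+1) *m (const_mx 1 : 'rV_n.+1).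
  by apply/matrixP => i j; rewrite !mxE big_ord1 !mxE.
have := det_scalar_sub_mulmxC a (const_mx b : 'cV_n.+1) (const_mx 1 : 'rV_n.+1).
rewrite expr1 => ->; rewrite exprS -mulrA det_mx11 !mxE eqxx mulr1n.
rewrite (eq_bigr (fun=> b)) => [|i _]; last by rewrite !mxE mul1r.
by rewrite sumr_const card_ord mulr_natl.
Qed.

Lemma char_poly_scale_triangular (C : numClosedFieldType) (q : C) m :
  char_poly (q *: adjacency C (pairs m.+3) (@meet1 m.+3)) =
  ('X - (q * (2 * m.+1%:R))%:P) * ('X - (q * (m.+3%:R - 4))%:P) ^+ m.+2
  * ('X - (- (2 * q))%:P) ^+ ('C(m.+3, 2) - m.+3).
Proof.
(* Exchanging the factors turns a determinant of size ['C(m.+3, 2)] into one of size [m.+3]. The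
   surplus power of [a] is the last factor of the claim, and this bound makes the truncated
   subtraction in its exponent exact. *)
have CM : (m.+3 <= 'C(m.+3, 2))%N by rewrite bin2; nia.
set a := 'X - (- (2 * q))%:P; have a0 : a != 0 by rewrite polyXsubC_eq0.
apply: (mulfI (expf_neq0 m.+3 a0)).
rewrite mulrCA -exprD subnKC // /char_poly /char_poly_mx.
pose r := map_mx polyC (incidence C m.+3).
(* The shift by [2 * q] in [a] absorbs the scalar part of [incidence_mul_tr]. *)
have -> : 'X%:M - map_mx polyC (q *: adjacency C (pairs m.+3) (@meet1 m.+3))
    = a%:M - r *m (q%:P *: r^T).
  rewrite -scalemxAr /r map_trmx -map_mxM incidence_mul_tr /a.
  apply/matrixP => i j; rewrite !mxE.
  case: eqP => _; rewrite ?mulr1n ?mulr0n; ring.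
rewrite (det_scalar_sub_mulmxC a r) [in X in a ^+ X * _]card_pairs mulrC.
congr (_ * _).
rewrite -scalemxAl /r map_trmx -map_mxM tr_incidence_mul.
(* The scalar part [m.+1] less the 2 from the shift in [a] is [m.+3 - 4]. *)
have -> : a%:M - q%:P *: map_mx polyC (m.+1%:R%:M + const_mx 1)
    = ('X - (q * (m.+3%:R - 4))%:P)%:M - q%:P *: const_mx 1 :> 'M_m.+3.
  apply/matrixP => i j; rewrite !mxE /a.
  case: eqP => _; rewrite ?mulr1n ?mulr0n; ring.
rewrite det_scalar_sub_scale_allones ?polyXsubC_eq0 // mulrC; congr (_ * _).
ring.
Qed.

(** * Graphs that repeat each vertex of the triangular graph *)

(** Each 2-subset is replaced by [q] mutually nonadjacent vertices with the same neighbours. This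
    interface carries all that the spectral computation takes from the group. *)
Definition pair_blowup (T : finType) (V : {set T}) (e : rel T) (m q : nat)
    (s : T -> {set 'I_m}) : Prop :=
  [/\ {in V, forall x, s x \in pairs m},
      {in pairs m, forall A, #|[set x in V | s x == A]| = q}
    & {in V &, forall x y, e x y = meet1 (s x) (s y)}].

Lemma pair_blowup_sum (T : finType) (V : {set T}) (e : rel T) m q
    (s : T -> {set 'I_m}) (P : pred {set 'I_m}) : pair_blowup V e q s ->
  #|[set x in V | P (s x)]| = (q * #|[set A in pairs m | P A]|)%N.
Proof.
move=> [sV fib _]; rewrite -[LHS]sum1_card mulnC -sum_nat_const.
rewrite (partition_big s [in [set A in pairs m | P A]]) => [|x]; last first.
  by rewrite !inE => /andP[/sV]; rewrite inE => -> ->.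
apply: eq_bigr => A; rewrite inE => /andP[/fib <- PA].
rewrite -[RHS]sum1_card; apply: eq_bigl => x; rewrite !inE -andbA.
by case: eqP => [->|]; rewrite ?PA // andbF.
Qed.

Lemma pair_blowup_card (T : finType) (V : {set T}) (e : rel T) m q
    (s : T -> {set 'I_m}) : pair_blowup V e q s -> #|V| = (q * 'C(m, 2))%N.
Proof.
move=> Vs; rewrite -card_pairs.
transitivity #|[set x in V | predT (s x)]|.
  by apply: eq_card => x; rewrite !inE andbT.
rewrite (pair_blowup_sum _ Vs); congr (_ * _)%N.
by apply: eq_card => A; rewrite !inE andbT.
Qed.

Lemma pair_blowup_regular (T : finType) (V : {set T}) (e : rel T) m q
    (s : T -> {set 'I_m}) : pair_blowup V e q s ->
  regular_graph V e (q * (2 * (m - 2))).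
Proof.
move=> Vs x xV; have [sV _ eE] := Vs.
have := sV x xV; rewrite inE => /eqP /card_pairs_meeting.
rewrite card_ord => <-.
transitivity #|[set y in V | meet1 (s x) (s y)]|.
  by apply: eq_card => y; rewrite !inE; case: (boolP (y \in V)) => //= yV;
    rewrite eE.
rewrite (pair_blowup_sum _ Vs); congr (_ * _)%N.
by apply: eq_card => A; rewrite !inE.
Qed.

Lemma pair_blowup_char_poly (C : numClosedFieldType) (T : finType) (V : {set T})
    (e : rel T) m q (s : T -> {set 'I_m}) : pair_blowup V e q s ->
  'X^('C(m, 2)) * char_poly (adjacency C V e) =
  'X^#|V| * char_poly (q%:R *: adjacency C (pairs m) (@meet1 m)).
Proof.
move=> [sV fib eE].
pose F : 'M[C]_(#|V|, #|pairs m|) :=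
  \matrix_(i, k) (s (enum_val i) == enum_val k)%:R.
(* Row [i] of [F] has a single 1, in the column of [s (enum_val i)]. *)
have sumF (i : 'I_#|V|) (f : {set 'I_m} -> C) :
    \sum_k F i k * f (enum_val k) = f (s (enum_val i)).
  have iV : enum_val i \in V := enum_valP i.
  under eq_bigr do rewrite mxE.
  rewrite -(big_enum_val (fun A => (s (enum_val i) == A)%:R * f A)) /=.
  rewrite (bigD1 (s (enum_val i))) ?sV //= eqxx mul1r big1 ?addr0 // => A.
  by rewrite eq_sym => /andP[_ /negbTE ->]; rewrite mul0r.
set S := adjacency C (pairs m) (@meet1 m).
have -> : adjacency C V e = F *m (S *m F^T).
  apply/matrixP => i j; rewrite !mxE eE; try exact: enum_valP.
  rewrite -[LHS](sumF i (fun A => (meet1 A (s (enum_val j)))%:R)).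
  apply: eq_bigr => k _; congr (_ * _); rewrite mxE.
  rewrite -[LHS](sumF j (fun A => (meet1 (enum_val k) A)%:R)).
  by apply: eq_bigr => l _; rewrite !mxE mulrC.
rewrite -[in LHS]card_pairs char_poly_mulmxC -mulmxA.
(* Distinct columns of [F] have disjoint supports, and each column has one 1 for every element of a
   fibre of size [q]. *)
suff -> : F^T *m F = q%:R%:M by rewrite mul_mx_scalar.
apply/matrixP => k l; rewrite !mxE.
have kP : enum_val k \in pairs m := enum_valP k.
under eq_bigr do rewrite !mxE.
rewrite -(big_enum_val
  (fun x => (s x == enum_val k)%:R * (s x == enum_val l)%:R)) /=.
rewrite -(fib _ kP) -(sumr_const _ 1) -sumrMnl.
rewrite [RHS](eq_bigl (fun x => (x \in V) && (s x == enum_val k))); last first.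
  by move=> x; rewrite inE.
rewrite big_mkcondr; apply: eq_bigr => x _.
by case: eqP => [->|]; rewrite ?mul0r // mul1r (inj_eq enum_val_inj).
Qed.

Lemma pair_blowup_spectrum (C : numClosedFieldType) (T : finType) (V : {set T})
    (e : rel T) m q (s : T -> {set 'I_m}) :
  (3 <= m)%N -> (0 < q)%N -> pair_blowup V e q s ->
  graph_spectrum_star V e (2 * q * (m - 2))
    [:: (q%:R * (m%:R - 4), (m - 1)%N);
        (- (2 * q%:R), ((m * (m - 3)) %/ 2)%N)] (0 : C).
Proof.
case: m s => [|[|[|m]]] // s _ q0 Vs; split.
  by rewrite [(2 * q)%N]mulnC -mulnA; apply: pair_blowup_regular Vs.
have CM : ('C(m.+3, 2) - m.+3 = (m.+3 * (m.+3 - 3)) %/ 2)%N.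
  by rewrite bin2 divn2; nia.
have VM : ('C(m.+3, 2) <= #|V|)%N.
  by rewrite (pair_blowup_card Vs) leq_pmull.
(* The degree and the two listed eigenvalues have total multiplicity ['C(m.+3, 2)]; all other
   eigenvalues are 0. *)
exists (#|V| - 'C(m.+3, 2))%N.
(* Equality of the multisets of roots reduces to equality of the products of linear factors, one of
   which is the characteristic polynomial. *)
apply: prod_XsubC_eq; rewrite /spectrum.
case: closed_field_poly_normal => r rE; rewrite [sval _]/=.
have /monicP lc := char_poly_monic (adjacency C V e).
rewrite lc scale1r in rE.
rewrite -rE.
have X0 : ('X^('C(m.+3, 2)) : {poly C}) != 0 by rewrite expf_neq0 // polyX_eq0.
apply: (mulfI X0); rewrite (pair_blowup_char_poly C Vs).
rewrite char_poly_scale_triangular.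
have prod_nseq c (x : C) : \prod_(z <- nseq c x) ('X - z%:P) = ('X - x%:P) ^+ c.
  by rewrite big_nseq -Monoid.iteropE.
rewrite big_cons big_cat big_flatten big_map !big_cons !big_nil !prod_nseq /=.
have -> : (2 * q * (m.+3 - 2))%:R = q%:R * (2 * m.+1%:R) :> C.
  by rewrite !natrM !subSS subn0; ring.
by rewrite subr0 -CM -[X in 'X^X * _ = _](subnKC VM) exprD !exprS; ring.
Qed.

(** * Transpositions and their supports *)

Definition support_perm m (s : 'S_m) : {set 'I_m} := [set i | s i != i].

Lemma support_tperm m (x y : 'I_m) : x != y ->
  support_perm (tperm x y) = [set x; y].
Proof.
move=> xy; apply/setP => i; rewrite !inE.
by case: tpermP => [->|->|/eqP/negbTE -> /eqP/negbTE ->];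
  rewrite ?eqxx ?orbT // eq_sym xy ?orbT.
Qed.

Lemma transpositionsP m (s : 'S_m) :
  reflect (exists2 p : 'I_m * 'I_m, p.1 != p.2 & s = tperm p.1 p.2)
    (s \in transpositions m).
Proof.
apply: (iffP imsetP) => [[p]|[p pP ->]]; first by rewrite inE; exists p.
by exists p; rewrite ?inE.
Qed.

Lemma support_transposition m (s : 'S_m) : s \in transpositions m ->
  support_perm s \in pairs m.
Proof.
by move=> /transpositionsP[p pP ->]; rewrite inE support_tperm // cards2 pP.
Qed.

(** Rewrites a transposition from any chosen moved point, which avoids case distinctions on the two
    points that name it. *)
Lemma transposition_tperm m (s : 'S_m) (a : 'I_m) : s \in transpositions m ->
  a \in support_perm s -> s = tperm a (s a).
Proof.
move=> /transpositionsP[[x y] /= xy ->]; rewrite support_tperm // !inE.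
by case/orP => /eqP ->; rewrite ?tpermL // tpermR tpermC.
Qed.

Lemma support_transpositionE m (s : 'S_m) (a : 'I_m) : s \in transpositions m ->
  a \in support_perm s -> support_perm s = [set a; s a].
Proof.
move=> sT aS; rewrite {1}(transposition_tperm sT aS) support_tperm //.
by move: aS; rewrite inE eq_sym.
Qed.

Lemma support_perm_inj m : {in transpositions m &, injective (@support_perm m)}.
Proof.
move=> s t sT tT st.
have := support_transposition sT; rewrite inE => /cards2P[a [b [ab sE]]].
have aS : a \in support_perm s by rewrite sE !inE eqxx.
have aT : a \in support_perm t by rewrite -st.
rewrite (transposition_tperm sT aS) (transposition_tperm tT aT); congr tperm.
have sa : s a != a by move: aS; rewrite inE.
move: st; rewrite (support_transpositionE sT aS) (support_transpositionE tT aT).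
by move=> /setP/(_ (s a)); rewrite !inE eqxx orbT (negbTE sa) => /esym/eqP.
Qed.

(** If the supports share only [a], then [s] fixes [t a] and [t] fixes [s a], so [s * t] sends [a]
    to [s a] while [t * s] sends it to the different point [t a]. *)
Lemma meet1_support_perm m (s t : 'S_m) :
    s \in transpositions m -> t \in transpositions m ->
  meet1 (support_perm s) (support_perm t) = (s * t != t * s)%g.
Proof.
move=> sT tT; apply/idP/idP => [/cards1P[a st]|].
  have := set11 a; rewrite -st inE => /andP[aS aT].
  have sa : s a != a by move: aS; rewrite inE.
  have ta : t a != a by move: aT; rewrite inE.
  have sta : s a != t a.
    apply: contra sa => /eqP sta; rewrite -in_set1 -st inE.
    rewrite (support_transpositionE sT aS) (support_transpositionE tT aT) -sta.
    by rewrite !inE eqxx orbT.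
  apply/eqP => /permP/(_ a); rewrite !permM.
  have -> : t (s a) = s a.
    by rewrite {1}(transposition_tperm tT aT); apply: tpermD; rewrite // eq_sym.
  have -> : s (t a) = t a.
    by rewrite {1}(transposition_tperm sT aS); apply: tpermD; rewrite // eq_sym.
  by move=> sta'; rewrite sta' eqxx in sta.
(* Supports that do not meet in exactly one point are equal or disjoint. Equal supports give equal
   transpositions, and disjoint ones give commuting transpositions. *)
apply: contraR => nst.
have pair u : u \in transpositions m -> #|support_perm u| = 2%N.
  by move=> /support_transposition; rewrite inE => /eqP.
have := cardsI_pairs (pair s sT) (pair t tT).
rewrite -[_ == 1%N]/(meet1 _ _) (negbTE nst) add0n.
case: eqP => [/support_perm_inj -> //|_ /eqP].
rewrite cards_eq0 setI_eq0 => dst.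
apply/eqP; apply: (perm_onC _ _ dst); apply/subsetP => i; rewrite !inE //.
Qed.

(** * From the 3-transposition group to the repeated triangular graph *)

Local Open Scope group_scope.

Lemma involutions_commute (gT : finGroupType) (x y : gT) :
  x ^+ 2 = 1 -> y ^+ 2 = 1 -> (x * y == y * x) = ((x * y) ^+ 2 == 1).
Proof.
move=> x2 y2.
have inv z : z ^+ 2 = 1 :> gT -> z^-1 = z.
  by move=> z2; apply/eqP; rewrite eq_invg_mul -expg2 z2.
by rewrite expg2 -eq_invg_mul invMg !inv // eq_sym.
Qed.

(** The map sends [d] to the support of its image [t d] in ['S_m]. Its fibres are the sets
    [D :&: d *: N], and adjacency of [d] and [e] amounts to [t d] and [t e] not commuting. *)
Lemma three_transposition_blowup (gT : finGroupType) (G : {group gT})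
    (D : {set gT}) m h :
  three_transposition_group G D -> has_type_2h_Sym G D h m ->
  exists s : gT -> {set 'I_m}, pair_blowup D (@diagram gT) (2 ^ h) s.
Proof.
case=> _ genD ordD ordDD [N [nsNG pN fibD [f /isomP[injf _] fD]]].
have sDG : D \subset G by rewrite -genD subset_gen.
have nND : {in D, forall d, d \in 'N(N)}.
  by move=> d /(subsetP sDG); apply/subsetP; apply: normal_norm.
have cG d : d \in D -> coset N d \in G / N.
  by move=> dD; rewrite mem_quotient // (subsetP sDG).
pose t d := f (coset N d).
have tT d : d \in D -> t d \in transpositions m.
  move=> dD; rewrite -fD; apply: mem_morphim; first exact: cG.
  by apply: mem_morphim; rewrite ?nND.
have tM : {in D &, {morph t : x y / x * y}}.
  by move=> x y xD yD; rewrite /t morphM ?nND // morphM ?cG //.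
have t1 : {in D &, forall x y, t (x * y) = 1 -> x * y \in N}.
  move=> x y xD yD xy1; apply: coset_idr; first by rewrite groupM ?nND.
  apply: (injmP injf); rewrite ?morph1 // mem_quotient //.
  by rewrite groupM ?(subsetP sDG).
exists (fun d => support_perm (t d)); split=> [d dD|A|d e dD eD].
- exact/support_transposition/tT.
- rewrite inE => /cards2P[x [y [xy ->]]].
  have : tperm x y \in f @* (D / N).
    by rewrite fD; apply/transpositionsP; exists (x, y).
  case/morphimP => _ _ /morphimP[d _ dD ->] dxy.
  rewrite -(fibD d dD); apply: eq_card => e; rewrite in_set in_setI.
  case: (boolP (e \in D)) => //= eD.
  (* Since [d] normalises [N], its left coset is also the right coset, and membership in that
     becomes equality of images under [coset N]. *)
  rewrite -norm_rlcoset ?nND // -support_tperm //.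
  rewrite (inj_in_eq (@support_perm_inj m)) ?tT // dxy; last exact: tT.
  rewrite (inj_in_eq (injmP injf)) ?cG //.
  by apply/eqP/rcoset_kercosetP; rewrite ?nND.
rewrite meet1_support_perm ?tT // /diagram.
have sq x : x \in D -> x ^+ 2 = 1 by move=> xD; rewrite -(ordD x xD) expg_order.
have sqt x : x \in D -> t x ^+ 2 = 1.
  by move=> /tT/transpositionsP[p _ ->]; rewrite expg2 tperm2.
rewrite involutions_commute ?sqt // -tM //.
have tX k : (d * e) ^+ k = 1 -> t (d * e) ^+ k = 1.
  have nde : d * e \in 'N(N) by rewrite groupM ?nND.
  have cde : coset N (d * e) \in G / N.
    by rewrite mem_quotient // groupM ?(subsetP sDG).
  by move=> dek; rewrite /t -morphX // -morphX // dek !morph1.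
(* If [d * e] has order 3 and its image squares to 1, that image is trivial, so [d * e] would be an
   element of order 3 in the 2-group [N]. Conversely, orders 1 and 2 both force the image to square
   to 1. *)
apply/eqP/idP => [de3|].
  apply/negP => /eqP t2.
  have t3 : t (d * e) ^+ 3 = 1 by rewrite tX // -de3 expg_order.
  have /t1 : t (d * e) = 1 by rewrite -t3 expgSr t2 mul1g.
  by move=> /(_ dD eD) /(mem_p_elt pN); rewrite /p_elt de3.
have := ordDD d e dD eD; rewrite !inE => /or3P[]/eqP // de; case/negP.
  by apply/eqP/tX/eqP; rewrite -order_dvdn de.
by apply/eqP/tX/eqP; rewrite -order_dvdn de.
Qed.

Local Close Scope group_scope.

Theorem proposition6p3 (C : numClosedFieldType) (gT : finGroupType)
    (G : {group gT}) (D : {set gT}) (m h : nat)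
    (hm : (4 <= m)%N)
    (h3t : three_transposition_group G D)
    (htype : has_type_2h_Sym G D h m) :
  #|D|%:R = 2 ^ (h%:Z - 1) * m%:R * (m%:R - 1) :> rat /\
  graph_spectrum_star D (@diagram gT) (2 ^ h.+1 * (m - 2))%N
    [:: (2 ^+ h * (m%:R - 4), (m - 1)%N);
        (- 2 ^+ h.+1, ((m * (m - 3)) %/ 2)%N)]
    (0 : C).
Proof.
have [s Ds] := three_transposition_blowup h3t htype; split; last first.
  rewrite exprS -natrX expnS.
  by apply: pair_blowup_spectrum Ds; rewrite ?expn_gt0 // ltnW.
(* The exponent [h%:Z - 1] is -1 when [h = 0], so the power is split over [rat] and its factor 1/2
   is absorbed by ['C(m, 2) * 2 = m * m.-1]. *)
rewrite (pair_blowup_card Ds) expfzDr // natrM natrX.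
have /(congr1 (fun n => n%:R : rat)) : ('C(m, 2) * 2 = m * m.-1)%N.
  by have := bin_ffact m 2; rewrite !ffactnS ffactn0 muln1.
rewrite !natrM -subn1 natrB 1?(leq_trans _ hm) // => C2.
by rewrite exprN1 -!mulrA -C2 -exprnP; field.
Qed.
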